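(* Let $L_1$ and $L_2$ be finite groups and let $(G,p_1,p_2)$ be a witness system for the compatibility of $(L_1,L_2)$ such that $|G|$ is minimal among all witness systems for the compatibility of $(L_1,L_2)$. If $\ker(p_1)$ or $\ker(p_2)$ has a nonabelian simple subnormal subgroup $T$, then there exist normal subgroups $M_1\trianglelefteq L_1$ and $M_2\trianglelefteq L_2$ such that $M_1\cong M_2\cong T^k$ for some $k\geq 1$, and $L_1/M_1$ and $L_2/M_2$ are compatible.
   Context: All groups are finite. Two groups $L_1$ and $L_2$ are compatible if there exists a finite group $G$ with normal subgroups $N_1$ and $N_2$ such that $N_1\cong N_2$ (as abstract groups), $L_1\cong G/N_1$ and $L_2\cong G/N_2$. A witness system for the compatibility of $(L_1,L_2)$ is a triple $(G,p_1,p_2)$ where $G$ is a finite group and $p_1:G\to L_1$ and $p_2:G\to L_2$ are surjective homomorphisms such that $\ker(p_1)\cong\ker(p_2)$. $T^k$ denotes the direct product of $k$ copies of $T$. *)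

(* Defs.v *)
From HB Require Import structures.
From mathcomp Require Import all_boot all_fingroup all_solvable.

Set Implicit Arguments.
Unset Strict Implicit.
Unset Printing Implicit Defensive.

Local Open Scope group_scope.

Definition compatible (gT1 gT2 : finGroupType)
    (L1 : {group gT1}) (L2 : {group gT2}) : Prop :=
  exists (gT : finGroupType) (G N1 N2 : {group gT}),
    [/\ N1 <| G, N2 <| G, N1 \isog N2, L1 \isog G / N1 & L2 \isog G / N2].

Definition is_witness_system (gT1 gT2 gT : finGroupType)
    (L1 : {group gT1}) (L2 : {group gT2}) (G : {group gT})
    (p1 : {morphism G >-> gT1}) (p2 : {morphism G >-> gT2}) : Prop :=
  [/\ p1 @* G = L1, p2 @* G = L2 & 'ker p1 \isog 'ker p2].

Definition is_minimal_witness_system (gT1 gT2 gT : finGroupType)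
    (L1 : {group gT1}) (L2 : {group gT2}) (G : {group gT})
    (p1 : {morphism G >-> gT1}) (p2 : {morphism G >-> gT2}) : Prop :=
  is_witness_system L1 L2 p1 p2 /\
  forall (hT : finGroupType) (H : {group hT})
         (q1 : {morphism H >-> gT1}) (q2 : {morphism H >-> gT2}),
    is_witness_system L1 L2 q1 q2 -> #|G| <= #|H|.

(* The external direct power T^k, inside the pointwise group of functions
   'I_k -> gT. *)
Definition direct_power (gT : finGroupType) (T : {group gT}) (k : nat) :
    {group {dffun forall _ : 'I_k, gT}} :=
  setXn_group (fun _ : 'I_k => T).

(* Main.v *)
Require Import Defs.
From HB Require Import structures.
From mathcomp Require Import all_boot all_fingroup all_solvable.

Set Implicit Arguments.
Unset Strict Implicit.
Unset Printing Implicit Defensive.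

Local Open Scope group_scope.

(** Write K1, K2 for the two kernels.  Nonabelian simple subnormal subgroups
  of a finite group behave rigidly: each of them is contained in or centralized
  by any given normal subgroup ([component_sub_or_cent]), two different ones
  centralize each other ([distinct_components_commute]), so any set of them
  generates its direct product ([components_dprod]), and this product meets
  trivially each normal subgroup that contains none of the factors
  ([components_TI]).

  Let Xi be the set of subnormal subgroups of Ki isomorphic to T and Ei the
  subgroup that Xi generates.  Since K1 and K2 are isomorphic, X1 and X2 have
  the same cardinality and K1 / E1 is isomorphic to K2 / E2.  If X1 = X2, then
  E1 = E2 is a nontrivial normal subgroup of G, and dividing G by it gives a
  smaller witness system ([minimal_witness_no_common_kernel]).  Hence X1 and X2
  are different sets of the same cardinality, and X2 minus X1 has the same
  cardinality k >= 1 as X1 minus X2.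

  Let J = E1 E2, generated by the union of X1 and X2, and Mi = pi(J).  The
  factors of J lying outside Ki generate a complement to Ei in J that meets Ki
  trivially.  Therefore Ki and J intersect in Ei ([setI_join_isotypic]), and Mi
  is a direct product of k copies of T ([morphim_join_isotypic]).  Finally
  Li / Mi is the quotient of G / J by Ki J / J, which is isomorphic to Ki / Ei;
  as K1 / E1 and K2 / E2 are isomorphic, G / J shows that L1 / M1 and L2 / M2
  are compatible. *)

(** * Nonabelian simple subnormal subgroups *)

Section SimpleComponents.

Variable gT : finGroupType.
Implicit Types (G H K S C D : {group gT}) (Y : {set {group gT}}).

(** These are the components of G, in the sense of the generalized Fitting
  subgroup, that are simple rather than just quasisimple. *)
Definition simple_component G S := [&& S <|<| G, simple S & ~~ abelian S].

Lemma simple_component_restrict G H S :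
  simple_component G S -> S \subset H -> H \subset G -> simple_component H S.
Proof.
case/and3P=> snS simS nabS sSH sHG; apply/and3P; split=> //.
by rewrite -(setIidPl sSH); apply: setI_subnormal sHG snS.
Qed.

Lemma nonabelian_simple_perfect S : simple S -> ~~ abelian S -> [~: S, S] = S.
Proof.
case/simpleP=> _ simS; rewrite (sameP derG1P eqP) -derg1 => ntS'.
by case: (simS _ (der_normal 1 S)) ntS' => [-> /eqP | ].
Qed.

Lemma nonabelian_simple_center S : simple S -> ~~ abelian S -> 'Z(S) = 1.
Proof.
case/simpleP=> _ simS nabS; case: (simS _ (center_normal S)) => // defZ.
by case/negP: nabS; apply/center_idP.
Qed.

(** By induction on the order of G, apply the dichotomy to K :&: M inside a
  proper normal subgroup M of G that contains S.  If S centralizes K :&: M,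
  which contains [~: K, S], then [~: K, S, S] = 1, and the three subgroup
  lemma gives [~: S, S, K] = 1, where [~: S, S] = S. *)
Lemma component_sub_or_cent G K S :
  simple_component G S -> K <| G -> S \subset K \/ K \subset 'C(S).
Proof.
have [n] := ubnP #|G|; elim: n G K => // n IHn G K ltGn compS nsKG.
have [snS simS nabS] := and3P compS.
have [defS | [M [snSM nsMG prMG]]] := subnormalEr snS.
  have [_ /(_ K)] := simpleP _ simS; rewrite defS => /(_ nsKG)[-> | ->].
    by right; rewrite sub1G.
  by left.
have sSM := subnormal_sub snSM; have [sMG nMG] := andP nsMG.
have [sKG nKG] := andP nsKG.
have compSM := simple_component_restrict compS sSM sMG.
have ltMn : #|M| < n by rewrite (leq_trans (proper_card prMG)) // -ltnS.
have [sSKM | cSKM] := IHn M (M :&: K)%G ltMn compSM (normalGI sMG nsKG).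
  by left; apply: subset_trans sSKM (subsetIr _ _).
right; rewrite -(nonabelian_simple_perfect simS nabS).
have KS_S : [~: K, S, S] = 1.
  apply/commG1P; apply: subset_trans cSKM.
  rewrite subsetI commg_subl (subset_trans (subset_trans sSM sMG) nKG) andbT.
  by rewrite (subset_trans (commgS _ sSM)) // commg_subr (subset_trans sKG nMG).
apply/commG1P; rewrite commGC; apply: three_subgroup => //.
by rewrite (commGC S K).
Qed.

(** Let M be a proper normal subgroup of G containing D.  Either M, and hence
  D, centralizes S, or S also lies in M and induction applies.  There is no
  such M only when D = G is simple, and then S = D. *)
Lemma distinct_components_commute G S D :
  simple_component G S -> simple_component G D -> S != D -> D \subset 'C(S).
Proof.
have [n] := ubnP #|G|; elim: n G => // n IHn G ltGn compS compD neqSD.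
have [snD simD nabD] := and3P compD; have [_ simS nabS] := and3P compS.
have [defD | [M [snDM nsMG prMG]]] := subnormalEr snD.
  (* Here G = D is simple, so that S, being nontrivial, must be D. *)
  have [snS _ _] := and3P compS; rewrite -defD in snS.
  have [eqSD | [K [snSK nsKD prKD]]] := subnormalEr snS.
    by case/eqP: neqSD; apply: val_inj.
  have [_ /(_ K nsKD)[K1 | KD]] := simpleP _ simD.
    by case/negP: nabS; apply: abelianS (subnormal_sub snSK) _; rewrite K1 abelian1.
  by rewrite KD properxx in prKD.
have sDM := subnormal_sub snDM.
have [sSM | cSM] := component_sub_or_cent compS nsMG; last first.
  exact: subset_trans cSM.
have sMG := normal_sub nsMG.
apply: (IHn M) neqSD; first by rewrite (leq_trans (proper_card prMG)) // -ltnS.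
  exact: simple_component_restrict compS sSM sMG.
exact: simple_component_restrict compD sDM sMG.
Qed.

Definition join_groups Y := (\prod_(C in Y) C)%G.

Lemma join_groups_subP Y (A : {group gT}) :
  reflect {in Y, forall C, C \subset A} (join_groups Y \subset A).
Proof. by rewrite bigprodGE gen_subG; apply: bigcupsP. Qed.

Lemma sub_join_groups Y C : C \in Y -> C \subset join_groups Y.
Proof. by move: C; apply/join_groups_subP. Qed.

Lemma join_groupsU Y1 Y2 :
  join_groups (Y1 :|: Y2) = (join_groups Y1 <*> join_groups Y2)%G.
Proof.
apply/eqP; rewrite -val_eqE eqEsubset join_subG; apply/and3P; split.
- apply/join_groups_subP=> C /setUP[] /sub_join_groups sC.
    exact: subset_trans sC (joing_subl _ _).
  exact: subset_trans sC (joing_subr _ _).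
- by apply/join_groups_subP=> C YC; rewrite sub_join_groups // inE YC.
by apply/join_groups_subP=> C YC; rewrite sub_join_groups // inE YC orbT.
Qed.

(** A factor C commutes with all the others, so it meets the group that they
  generate inside its own center, which is trivial. *)
Lemma components_dprod G Y :
    {in Y, forall C, simple_component G C} ->
  \big[dprod/1]_(C in Y) gval C = join_groups Y.
Proof.
move=> compY; apply/eqP/bigdprodYP=> C YC.
have [_ simC nabC] := and3P (compY C YC).
set J := (\prod_(j | _) _)%G.
have cJ : J \subset 'C(C).
  rewrite bigprodGE gen_subG; apply/bigcupsP=> D /andP[YD neqDC].
  by apply: (@distinct_components_commute G); rewrite ?compY // eq_sym.
rewrite subsetD cJ -setI_eq0 setIDA setD_eq0 /=.
apply: subset_trans (_ : 'Z(C) \subset _); first by rewrite setIC setIS.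
by rewrite (nonabelian_simple_center simC nabC).
Qed.

(** Each factor not contained in K is centralized by K, so the intersection is
  central in the direct product of the factors, whose center is trivial. *)
Lemma components_TI G K Y :
    {in Y, forall C, simple_component G C} -> K <| G ->
    {in Y, forall C, ~~ (C \subset K)} ->
  K :&: join_groups Y = 1.
Proof.
move=> compY nsKG notYK; apply/trivgP.
have Z1 : 'Z(join_groups Y) = 1.
  rewrite -(center_bigdprod (components_dprod compY)) big1 // => C YC.
  by have [_ simC nabC] := and3P (compY C YC); apply: nonabelian_simple_center.
rewrite /= -Z1 setIC setIS // centsC; apply/join_groups_subP=> C YC; rewrite centsC.
by have [/idPn[] | //] := component_sub_or_cent (compY C YC) nsKG; apply: notYK.
Qed.

End SimpleComponents.

Lemma isog_bigdprod (aT bT : finGroupType) (I : Type) (r : seq I)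
    (A : I -> {set aT}) (B : I -> {set bT}) (G : {group aT}) (H : {group bT}) :
    \big[dprod/1]_(i <- r) A i = G -> \big[dprod/1]_(i <- r) B i = H ->
    (forall i, A i \isog B i) ->
  G \isog H.
Proof.
move=> defG defH isoAB; elim: r G H defG defH => [|i r IHr] G H.
  by rewrite !big_nil => defG defH; apply: trivial_isog.
rewrite !big_cons => defG defH.
case/dprodP: (defG) => [[_ G' _ defG'] _ _ _].
case/dprodP: (defH) => [[_ H' _ defH'] _ _ _].
apply: isog_dprod defG defH (isoAB i) _; rewrite defG' defH'.
exact: IHr.
Qed.

(** * Simple components of a given isomorphism type *)

Section IsotypicComponents.

Variables (gT : finGroupType) (T : {group gT}).
Hypotheses (simT : simple T) (nabT : ~~ abelian T).
Implicit Types (G H K C : {group gT}) (Y : {set {group gT}}).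

Definition isotypic_components K : {set {group gT}} :=
  [set C : {group gT} | (C <|<| K) && (C \isog T)].

Local Notation X := isotypic_components.
Local Notation E K := (join_groups (X K)).

Lemma isotypic_simple_component G K :
  K <| G -> {in X K, forall C, simple_component G C}.
Proof.
move=> nsKG C; rewrite inE => /andP[snC isoC].
rewrite /simple_component (isog_simple isoC) (isog_abelian isoC) simT nabT.
by rewrite (subnormal_trans snC (normal_subnormal nsKG)).
Qed.

Lemma isotypic_components_sub G K C :
  K <| G -> C \in X G -> (C \in X K) = (C \subset K).
Proof.
move=> nsKG; rewrite !inE => /andP[snC ->]; rewrite andbT.
apply/idP/idP=> [/subnormal_sub // | sCK].
by rewrite -(setIidPl sCK); apply: setI_subnormal (normal_sub nsKG) snC.
Qed.

Lemma isotypic_componentsS G K : K <| G -> X K \subset X G.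
Proof.
move=> nsKG; apply/subsetP=> C; rewrite !inE => /andP[snC ->].
by rewrite (subnormal_trans snC (normal_subnormal nsKG)).
Qed.

Lemma join_isotypic_sub K : E K \subset K.
Proof.
by apply/join_groups_subP=> C; rewrite inE => /andP[/subnormal_sub].
Qed.

Lemma join_isotypic_isog Y :
    {in Y, forall C, C \isog T} ->
    \big[dprod/1]_(C in Y) gval C = join_groups Y ->
  join_groups Y \isog direct_power T #|Y|.
Proof.
move=> isoY; rewrite big_enum_val /= => defJ.
apply: isog_bigdprod defJ (setXn_dprod (fun _ : 'I_#|Y| => T)) _ => i.
apply: (@isog_trans _ _ _ _ T (groupXn1 T)) (isoY _ (enum_valP i)) _.
exact: (@isog_setXn _ (fun _ : 'I_#|Y| => gT) i T).
Qed.

Lemma injm_isotypic (H K : {group gT}) (f : {morphism K >-> gT}) C :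
  'injm f -> f @* K = H -> C \in X K -> (f @* C)%G \in X H.
Proof.
move=> injf defH; rewrite !inE /= -defH => /andP[snC isoC].
rewrite morphim_subnormal //=; apply: isog_trans isoC.
by rewrite isog_sym; apply: sub_isog (subnormal_sub snC) injf.
Qed.

Lemma card_isotypic_isog (H K : {group gT}) : K \isog H -> #|X K| = #|X H|.
Proof.
have le (A B : {group gT}) : A \isog B -> #|X A| <= #|X B|.
  case/isogP=> f injf defB.
  rewrite -(card_in_imset (f := fun C : {group gT} => (f @* C)%G)).
    by apply/subset_leq_card/subsetP=> _ /imsetP[C XC ->]; apply: injm_isotypic.
  move=> C D; rewrite !inE => /andP[/subnormal_sub sCA _] /andP[/subnormal_sub sDA _].
  by move/(congr1 val)=> /= eqCD; apply/val_inj/(injm_morphim_inj injf sCA sDA).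
by move=> isoKH; apply/eqP; rewrite eqn_leq !le // isog_sym.
Qed.

(** The image of E K lies in E H; equality follows by comparing orders, because
  the two groups are direct products of equally many groups of order #|T|. *)
Lemma injm_join_isotypic (H K : {group gT}) (f : {morphism K >-> gT}) :
  'injm f -> f @* K = H -> f @* E K = E H.
Proof.
move=> injf defH.
have isoKH : K \isog H by apply/isogP; exists f.
have cardE (A : {group gT}) : #|E A| = (#|T| ^ #|X A|)%N.
  rewrite -(bigdprod_card (components_dprod (isotypic_simple_component (normal_refl A)))).
  rewrite (eq_bigr (fun _ => #|T|)) ?prod_nat_const // => C.
  by rewrite inE => /andP[_ /card_isog].
apply/eqP; rewrite eqEcard card_injm ?join_isotypic_sub // !cardE.
rewrite (card_isotypic_isog isoKH) leqnn andbT.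
rewrite sub_morphim_pre ?join_isotypic_sub //; apply/join_groups_subP=> C XC.
rewrite -sub_morphim_pre; last first.
  by move: XC; rewrite inE => /andP[/subnormal_sub].
exact: (sub_join_groups (injm_isotypic injf defH XC)).
Qed.

Lemma join_isotypic_char K : E K \char K.
Proof.
apply/charP; split=> [|f injf defK]; first exact: join_isotypic_sub.
exact: injm_join_isotypic.
Qed.

Lemma quotient_join_isotypic_isog (H K : {group gT}) :
  K \isog H -> K / E K \isog H / E H.
Proof.
case/isogP=> f injf defH; have nsE := char_normal (join_isotypic_char K).
rewrite -(injm_join_isotypic injf defH) -defH.
apply/isogP; exists (quotm_morphism f nsE); first exact: injm_quotm.
exact: morphim_quotm.
Qed.

(** The members of Y outside X K are the simple factors of join_groups Y not
  contained in K, so the group that they generate meets K trivially and is a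
  complement to E K in join_groups Y. *)
Section OverKernel.

Variables (G K : {group gT}) (Y : {set {group gT}}).
Hypotheses (nsKG : K <| G) (sYX : Y \subset X G) (sXY : X K \subset Y).

Let compYX : {in Y :\: X K, forall C, simple_component G C}.
Proof.
move=> C /setDP[/(subsetP sYX) XC _].
exact: isotypic_simple_component (normal_refl G) C XC.
Qed.

Let TI_KYX : K :&: join_groups (Y :\: X K) = 1.
Proof.
apply: components_TI compYX nsKG _ => C /setDP[/(subsetP sYX) XC].
by rewrite (isotypic_components_sub nsKG XC).
Qed.

Let joinY : join_groups Y :=: E K <*> join_groups (Y :\: X K).
Proof. by rewrite -{1}(setIidPr sXY) -{1}(setID Y (X K)) join_groupsU. Qed.

(** Dedekind's modular law, applied to E K, which is contained in K, and its
  complement, which meets K trivially. *)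
Lemma setI_join_isotypic : K :&: join_groups Y = E K.
Proof.
have sJG : join_groups (Y :\: X K) \subset G.
  by apply/join_groups_subP=> C /compYX/and3P[/subnormal_sub].
have nsEG : E K <| G := char_normal_trans (join_isotypic_char K) nsKG.
rewrite joinY norm_joinEr ?(subset_trans sJG (normal_norm nsEG)) //.
by rewrite setIC -group_modl ?join_isotypic_sub // setIC TI_KYX mulg1.
Qed.

(** The morphism p kills E K and is injective on its complement. *)
Lemma morphim_join_isotypic (rT : finGroupType) (p : {morphism G >-> rT}) :
  'ker p = K -> p @* join_groups Y \isog direct_power T #|Y :\: X K|.
Proof.
move=> kerp; set J := join_groups (Y :\: X K).
have sJG : J \subset G.
  by apply/join_groups_subP=> C /compYX/and3P[/subnormal_sub].
have sEG : E K \subset G := subset_trans (join_isotypic_sub K) (normal_sub nsKG).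
have -> : p @* join_groups Y = p @* J.
  rewrite joinY morphimY //.
  have -> : p @* E K = 1.
    by apply/trivgP; rewrite -(morphim_ker p) morphimS // kerp join_isotypic_sub.
  by rewrite joing1G.
have isoJ : J \isog p @* J.
  apply/isogP; exists (restrm_morphism sJG p); last by rewrite /= morphim_restrm setIid.
  by rewrite ker_restrm kerp setIC TI_KYX.
apply: isog_trans (join_isotypic_isog _ (components_dprod compYX)).
  by rewrite isog_sym.
by move=> C /setDP[/(subsetP sYX)]; rewrite inE => /andP[].
Qed.

End OverKernel.

End IsotypicComponents.

(** * Quotients of witness systems *)

(** Both sides are isomorphic to G / ('ker f <*> N). *)
Lemma morphim_quotient_isog (aT rT : finGroupType) (G N : {group aT})
    (f : {morphism G >-> rT}) :
  N <| G -> f @* G / f @* N \isog (G / N) / ('ker f / N).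
Proof.
move=> nsNG; have nsKG := ker_normal f; have nsKN := normalY nsKG nsNG.
apply: isog_trans (_ : G / ('ker f <*> N) \isog _); last first.
  rewrite isog_sym -(quotientYidr (subset_trans (normal_sub nsKG) (normal_norm nsNG))).
  exact: third_isog (joing_subr _ _) nsNG nsKN.
rewrite isog_sym; apply: isog_trans (_ : _ \isog (G / 'ker f) / (N / 'ker f)) _.
  rewrite isog_sym -(quotientYidl (subset_trans (normal_sub nsNG) (normal_norm nsKG))).
  exact: third_isog (joing_subl _ _) nsKG nsKN.
have [g injg im_g] := first_isom f.
have nsNK := quotient_normal ('ker f)%G nsNG.
apply/isogP; rewrite -[f @* N]im_g; exists (quotm_morphism g nsNK).
  exact: injm_quotm.
by rewrite [LHS]morphim_quotm !im_g.
Qed.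

(** Otherwise p1 and p2 factor through the smaller group G / N, where their
  kernels become 'ker p1 / N and 'ker p2 / N. *)
Lemma minimal_witness_no_common_kernel (gT1 gT2 gT : finGroupType)
    (L1 : {group gT1}) (L2 : {group gT2}) (G N : {group gT})
    (p1 : {morphism G >-> gT1}) (p2 : {morphism G >-> gT2}) :
    is_minimal_witness_system L1 L2 p1 p2 -> N <| G ->
    N \subset 'ker p1 -> N \subset 'ker p2 ->
  'ker p1 / N \isog 'ker p2 / N -> N :=: 1.
Proof.
move=> [[im1 im2 _] minG] nsNG sNK1 sNK2 isoK; have [sNG nNG] := andP nsNG.
have sK1 : 'ker (coset N) \subset 'ker p1 by rewrite ker_coset.
have sK2 : 'ker (coset N) \subset 'ker p2 by rewrite ker_coset.
pose q1 := factm_morphism sK1 nNG; pose q2 := factm_morphism sK2 nNG.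
have /minG : is_witness_system L1 L2 q1 q2.
  split; [by rewrite morphim_factm | by rewrite morphim_factm |].
  by rewrite /= !ker_factm.
rewrite card_quotient // -divgS // => leGN; apply/eqP.
rewrite trivg_card_le1 leqNgt; apply/negP=> N_gt1.
by move: leGN; rewrite leqNgt ltn_Pdiv.
Qed.

Theorem lemma5p3 (gT1 gT2 : finGroupType)
    (L1 : {group gT1}) (L2 : {group gT2})
    (gT : finGroupType) (G : {group gT})
    (p1 : {morphism G >-> gT1}) (p2 : {morphism G >-> gT2})
    (minG : is_minimal_witness_system L1 L2 p1 p2)
    (T : {group gT}) (simT : simple T) (nabT : ~~ abelian T)
    (snT : T <|<| 'ker p1 \/ T <|<| 'ker p2) :
  exists (M1 : {group gT1}) (M2 : {group gT2}),
    [/\ M1 <| L1,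
        M2 <| L2,
        exists k : nat,
          [/\ 1 <= k, M1 \isog M2 & M2 \isog direct_power T k]
      & compatible (L1 / M1) (L2 / M2)].
Proof.
have [[im1 im2 isoK] _] := minG.
have nsK1 := ker_normal p1; have nsK2 := ker_normal p2.
set K1 := ('ker p1)%G in isoK nsK1 snT; set K2 := ('ker p2)%G in isoK nsK2 snT.
pose X1 := isotypic_components T K1; pose X2 := isotypic_components T K2.
have cardX : #|X1| = #|X2| := card_isotypic_isog T isoK.
have sX1G : X1 \subset isotypic_components T G := isotypic_componentsS T nsK1.
have sX2G : X2 \subset isotypic_components T G := isotypic_componentsS T nsK2.
pose E1 := join_groups X1; pose E2 := join_groups X2.
have isoKE : K1 / E1 \isog K2 / E2 := quotient_join_isotypic_isog simT nabT isoK.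
have nsE1 : E1 <| G := char_normal_trans (join_isotypic_char simT nabT K1) nsK1.
have nsE2 : E2 <| G := char_normal_trans (join_isotypic_char simT nabT K2) nsK2.
pose Y := X1 :|: X2; pose J := join_groups Y.
have nsJ : J <| G by rewrite /J join_groupsU normalY.
have sYG : Y \subset isotypic_components T G by rewrite subUset sX1G.
have sX1Y : X1 \subset Y := subsetUl _ _.
have sX2Y : X2 \subset Y := subsetUr _ _.
(* Indeed Y :\: X2 = X1 :\: X2 and Y :\: X1 = X2 :\: X1. *)
have cardD : #|Y :\: X2| = #|Y :\: X1|.
  by rewrite !cardsD (setIidPr sX1Y) (setIidPr sX2Y) cardX.
have JK1 : K1 :&: J = E1 := setI_join_isotypic simT nabT nsK1 sYG sX1Y.
have JK2 : K2 :&: J = E2 := setI_join_isotypic simT nabT nsK2 sYG sX2Y.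
have isoM1 : p1 @* J \isog direct_power T #|Y :\: X1| :=
  morphim_join_isotypic simT nabT nsK1 sYG sX1Y (erefl ('ker p1)).
have isoM2 : p2 @* J \isog direct_power T #|Y :\: X2| :=
  morphim_join_isotypic simT nabT nsK2 sYG sX2Y (erefl ('ker p2)).
exists (p1 @* J)%G, (p2 @* J)%G; split.
- by rewrite -im1 morphim_normal.
- by rewrite -im2 morphim_normal.
- exists #|Y :\: X2|; split=> //; last first.
    by rewrite cardD in isoM2; apply: isog_trans isoM1 _; rewrite isog_sym.
  rewrite lt0n cards_eq0 setD_eq0 subUset subxx andbT; apply/negP=> sX12.
  (* Now X1 = X2, and E1 is a common normal subgroup that can be divided out. *)
  have eqX : X1 = X2 by apply/eqP; rewrite eqEcard sX12 cardX leqnn.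
  have eqE : E2 = E1 by rewrite /E1 eqX.
  have sTE : T \subset E1.
    rewrite /E1; case: snT => snT; [|rewrite eqX];
      by apply: sub_join_groups; rewrite inE snT isog_refl.
  have E1_1 : E1 :=: 1.
    apply: (minimal_witness_no_common_kernel minG) => //.
    - exact: join_isotypic_sub T K1.
    - by rewrite -eqE; apply: (join_isotypic_sub T K2).
    by move: isoKE; rewrite eqE.
  by case/negP: nabT; apply: abelianS sTE _; rewrite E1_1 abelian1.
exists (coset_of J), (G / J)%G, (K1 / J)%G, (K2 / J)%G; split.
- exact: quotient_normal.
- exact: quotient_normal.
- have nJ (K : {group gT}) : K <| G -> K \subset 'N(J).
    by move/normal_sub=> sKG; apply: subset_trans sKG (normal_norm nsJ).
  have := second_isog (nJ K1 nsK1); have := second_isog (nJ K2 nsK2).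
  rewrite (setIC J) (setIC J) JK1 JK2 => iso2 iso1.
  by apply: isog_trans (isog_trans isoKE iso2); rewrite isog_sym.
- by rewrite /= -im1; apply: morphim_quotient_isog.
by rewrite /= -im2; apply: morphim_quotient_isog.
Qed.
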